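(* Let $(a_k)_{k\ge1}$ be an increasing sequence of positive integers such that $$\lim_{k\to\infty}\frac{a_{k+1}}{a_k}=\eta>1$$ for some transcendental number $\eta$. For $n\in\mathbb N$ let $S_n(\omega)=\sum_{k=1}^n\cos(2\pi a_k\omega)$, $\omega\in[0,1]$, viewed as a random variable on $[0,1]$ with Lebesgue measure. Then for every integer $m\ge1$, $$\kappa_m(S_n)-n\widetilde\kappa_m=\mathcal O(1)\qquad\text{as }n\to\infty .$$ In particular $\kappa_m(S_n)/n\to\widetilde\kappa_m$ as $n\to\infty$.
   Context: For a bounded random variable $X$, its $m$-th cumulant is $\kappa_m(X)=\frac{d^m}{dt^m}\log\mathbb E[e^{tX}]\big|_{t=0}$. The constants $\widetilde\kappa_m$ are the cumulants of the arcsine law, i.e. of $\cos(2\pi U)$ with $U$ uniform on $[0,1]$: $\widetilde\kappa_m=\frac{d^m}{dt^m}\log I_0(t)\big|_{t=0}$, where $I_0(t)=\sum_{j\ge0}\frac{(t/2)^{2j}}{(j!)^2}$ is the modified Bessel function of the first kind. Equivalently, $n\widetilde\kappa_m$ is the $m$-th cumulant of $\sum_{k=1}^n\cos(2\pi a_kU_k)$ with $U_1,U_2,\dots$ i.i.d. uniform on $[0,1]$. *)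

(* Defs.v *)
From Stdlib Require Import Reals ZArith.
From Coquelicot Require Import Coquelicot.
Open Scope R_scope.

Definition transcendental (eta : R) : Prop :=
  forall (d : nat) (c : nat -> Z),
    (exists i, (i <= d)%nat /\ c i <> 0%Z) ->
    sum_n_m (fun i => IZR (c i) * eta ^ i) 0 d <> 0.

Definition S_n (a : nat -> nat) (n : nat) (w : R) : R :=
  sum_n_m (fun k => cos (2 * PI * INR (a k) * w)) 1 n.

Definition cumulant01 (X : R -> R) (m : nat) : R :=
  Derive_n (fun t => ln (RInt (fun w => exp (t * X w)) 0 1)) m 0.

Definition I0 (t : R) : R :=
  Series (fun j => (t / 2) ^ (2 * j) / (INR (fact j)) ^ 2).

Definition arcsine_cumulant (m : nat) : R :=
  Derive_n (fun t => ln (I0 t)) m 0.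

(* Main.v *)
Require Import Defs.
From Stdlib Require Import Reals ZArith Lra Lia Factorial.
From Coquelicot Require Import Coquelicot.
Open Scope R_scope.

(* For every [m] there is [K] such that an integer relation
   [sum_j c_j a_j = 0] with [sum_j |c_j| <= m] involves no index above [K]:
   otherwise, dividing by the largest term and passing to the limit along
   [a_(k-j) / a_k -> eta^-j] would produce a polynomial relation for [eta].
   Hence for [k >= K] all mixed moments of order at most [m] of [S_k] and
   [cos (2 pi a_(k+1) w)] factor as if the two were independent.  Cumulants of
   order [m] only depend on moments of order at most [m], and [I0] is the moment
   generating function of [cos (2 pi U)], so
   [kappa_m(S_(k+1)) = kappa_m(S_k) + arcsine_cumulant m] exactly. *)

(** * Derivatives of logarithms *)

(* Differential polynomials in a function [f] and [1 / f]: the derivatives of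
   [ln f] are given by universal expressions of this kind, hence are determined
   by finitely many derivatives of [f]. *)
Inductive dexpr : Type :=
| DVar (i : nat) | DInv | DOpp (e : dexpr) | DAdd (e1 e2 : dexpr)
| DMul (e1 e2 : dexpr).

Fixpoint deval (f : R -> R) (e : dexpr) (x : R) : R :=
  match e with
  | DVar i => Derive_n f i x
  | DInv => / f x
  | DOpp e => - deval f e x
  | DAdd e1 e2 => deval f e1 x + deval f e2 x
  | DMul e1 e2 => deval f e1 x * deval f e2 x
  end.

Fixpoint dderiv (e : dexpr) : dexpr :=
  match e with
  | DVar i => DVar (S i)
  | DInv => DOpp (DMul (DVar 1) (DMul DInv DInv))
  | DOpp e => DOpp (dderiv e)
  | DAdd e1 e2 => DAdd (dderiv e1) (dderiv e2)
  | DMul e1 e2 => DAdd (DMul (dderiv e1) e2) (DMul e1 (dderiv e2))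
  end.

Fixpoint dorder (e : dexpr) : nat :=
  match e with
  | DVar i => i
  | DInv => 0
  | DOpp e => dorder e
  | DAdd e1 e2 | DMul e1 e2 => Nat.max (dorder e1) (dorder e2)
  end.

Definition smooth (f : R -> R) : Prop := forall n x, ex_derive_n f n x.

Lemma is_derive_deval (f : R -> R) (e : dexpr) (x : R) :
  smooth f -> (forall y, 0 < f y) ->
  is_derive (deval f e) x (deval f (dderiv e) x).
Proof.
intros Hs Hp; induction e as [i| |e IH|e1 IH1 e2 IH2|e1 IH1 e2 IH2]; simpl.
- apply Derive_correct; exact (Hs (S i) x).
- assert (H1 : is_derive f x (Derive f x)) by (apply Derive_correct; exact (Hs 1%nat x)).
  pose proof (Hp x) as Hx.
  evar_last; [apply (is_derive_inv f x _ H1); lra|].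
  change (Derive (fun x0 => f x0) x) with (Derive f x).
  field; lra.
- apply (is_derive_opp _ _ _ IH).
- exact (is_derive_plus _ _ _ _ _ IH1 IH2).
- exact (is_derive_mult _ _ _ _ _ IH1 IH2 Rmult_comm).
Qed.

Lemma dorder_dderiv (e : dexpr) : (dorder (dderiv e) <= S (dorder e))%nat.
Proof. induction e; simpl; lia. Qed.

Lemma deval_ext (f g : R -> R) (e : dexpr) (x : R) :
  (forall i, (i <= dorder e)%nat -> Derive_n f i x = Derive_n g i x) ->
  deval f e x = deval g e x.
Proof.
induction e as [i| |e IH|e1 IH1 e2 IH2|e1 IH1 e2 IH2]; simpl; intros H.
- apply H; lia.
- f_equal; exact (H 0%nat (le_n _)).
- rewrite IH; auto.
- rewrite IH1, IH2; auto; intros i Hi; apply H; lia.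
- rewrite IH1, IH2; auto; intros i Hi; apply H; lia.
Qed.

(** The seed is [f' / f], so [dlog n] encodes the derivative of order [n + 1] of [ln f]; the value
    [ln f] itself is not of this form. *)
Definition dlog (n : nat) : dexpr := Nat.iter n dderiv (DMul (DVar 1) DInv).

Lemma dorder_dlog (n : nat) : (dorder (dlog n) <= S n)%nat.
Proof.
induction n as [|n IH]; [simpl; lia|].
change (dlog (S n)) with (dderiv (dlog n)).
pose proof (dorder_dderiv (dlog n)); lia.
Qed.

Lemma Derive_n_ln (f : R -> R) (n : nat) (x : R) :
  smooth f -> (forall y, 0 < f y) ->
  Derive_n (fun t => ln (f t)) (S n) x = deval f (dlog n) x.
Proof.
intros Hs Hp; revert x; induction n as [|n IH]; intros x.
- apply is_derive_unique.
  assert (H1 : is_derive f x (Derive f x)) by (apply Derive_correct; exact (Hs 1%nat x)).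
  evar_last; [apply (is_derive_comp ln f x (/ f x) (Derive f x)); [|exact H1]|].
  + apply is_derive_Reals, derivable_pt_lim_ln, Hp.
  + reflexivity.
- change (Derive (Derive_n (fun t => ln (f t)) (S n)) x = deval f (dlog (S n)) x).
  rewrite (Derive_ext _ _ _ IH).
  apply is_derive_unique, (is_derive_deval f (dlog n) x Hs Hp).
Qed.

Lemma smooth_ln (f : R -> R) :
  smooth f -> (forall y, 0 < f y) -> smooth (fun t => ln (f t)).
Proof.
intros Hs Hp [|[|n]] x; [exact I| |].
- change (ex_derive (fun t => ln (f t)) x).
  exists (scal (Derive f x) (/ f x)).
  apply (is_derive_comp ln f x (/ f x) (Derive f x)); [apply is_derive_Reals, derivable_pt_lim_ln, Hp|].
  apply Derive_correct; exact (Hs 1%nat x).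
- change (ex_derive (Derive_n (fun t => ln (f t)) (S n)) x).
  apply (ex_derive_ext (deval f (dlog n))).
  + intros t; symmetry; apply Derive_n_ln; assumption.
  + eexists; apply is_derive_deval; assumption.
Qed.

(** Applied to moment generating functions at 0, this says that a cumulant of order [n] depends only
    on the moments of order at most [n]. *)
Lemma Derive_n_ln_ext (f g : R -> R) (n : nat) (x : R) :
  smooth f -> (forall y, 0 < f y) -> smooth g -> (forall y, 0 < g y) ->
  (forall i, (i <= n)%nat -> Derive_n f i x = Derive_n g i x) ->
  Derive_n (fun t => ln (f t)) n x = Derive_n (fun t => ln (g t)) n x.
Proof.
intros Hf Hf0 Hg Hg0 H; destruct n as [|n].
- simpl; f_equal; exact (H 0%nat (le_n _)).
- rewrite !Derive_n_ln by assumption.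
  apply deval_ext; intros i Hi; apply H.
  pose proof (dorder_dlog n); lia.
Qed.

(** * Moment generating functions *)

(** Beyond the radius of convergence the terms do not tend to 0, which is incompatible with
    convergence there. Hence every [Rabs x] is at most the radius. *)
Lemma CV_radius_entire (a : nat -> R) :
  (forall x, ex_pseries a x) -> CV_radius a = p_infty.
Proof.
intros H.
assert (Hle : forall x : R, Rbar_le (Rabs x) (CV_radius a)).
{ intros x; apply Rbar_not_lt_le; intros Hlt.
  apply (CV_disk_outside a x Hlt), ex_series_lim_0.
  apply (ex_series_ext (fun n => scal (pow_n x n) (a n))); [|exact (H x)].
  intros n; rewrite pow_n_pow; apply Rmult_comm. }
destruct (CV_radius a) as [r| |]; [|reflexivity|].
- specialize (Hle (Rabs r + 1)); simpl in Hle.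
  pose proof (Rle_abs (Rabs r + 1)); pose proof (Rle_abs r); lra.
- destruct (Hle 0).
Qed.

Lemma CV_radius_exp : CV_radius (fun n => / INR (fact n)) = p_infty.
Proof.
apply CV_radius_entire; intros x; exists (exp x); apply is_exp_Reals.
Qed.

(** The exponential series converges normally on every disc; the uniformity in [y] is what permits
    integration term by term. *)
Lemma exp_partial_sums_uniform (B : R) (eps : posreal) :
  exists N, forall n y, (N <= n)%nat -> Rabs y <= B ->
  Rabs (exp y - sum_f_R0 (fun k => / INR (fact k) * y ^ k) n) < eps.
Proof.
pose proof (Rle_abs B) as HB; pose proof (Rabs_pos B) as HB0.
(* The radius must be positive, and the open ball must contain the closed interval of radius [B]. *)
assert (Hr : 0 < Rabs B + 1) by lra.
set (r := mkposreal _ Hr).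
assert (HC : CVN_r (fun n x => / INR (fact n) * x ^ n) r).
{ apply (CV_radius_Reals_0 (fun n => / INR (fact n))); rewrite CV_radius_exp; exact I. }
assert (Hcv : forall x, {l | Un_cv (fun N => SP (fun n x => / INR (fact n) * x ^ n) N x) l}).
{ intros x; exists (exp x).
  pose proof (is_exp_Reals x) as He; apply is_pseries_Reals in He.
  exact He. }
destruct (CVN_CVU _ Hcv r HC eps (cond_pos eps)) as [N HN].
exists N; intros n y Hn Hy.
specialize (HN n y Hn).
assert (Hs : SFL (fun n x => / INR (fact n) * x ^ n) Hcv y = exp y).
{ unfold SFL; destruct (Hcv y) as [l Hl].
  apply (UL_sequence _ _ _ Hl).
  pose proof (is_exp_Reals y) as He; apply is_pseries_Reals in He; exact He. }
rewrite Hs in HN; apply HN.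
unfold Boule; simpl; rewrite Rminus_0_r; lra.
Qed.

Definition moment (X : R -> R) (p : nat) : R := RInt (fun w => X w ^ p) 0 1.

Definition mgf (X : R -> R) (t : R) : R := RInt (fun w => exp (t * X w)) 0 1.

Definition bounded_continuous (X : R -> R) : Prop :=
  (forall w, continuous X w) /\ exists B, forall w, Rabs (X w) <= B.

Lemma continuous_pow (X : R -> R) (p : nat) (w : R) :
  continuous X w -> continuous (fun w => X w ^ p) w.
Proof.
intros H; induction p as [|p IH]; simpl.
- apply continuous_const.
- exact (continuous_mult X (fun w => X w ^ p) w H IH).
Qed.

Lemma ex_RInt_continuous_R (f : R -> R) (a b : R) :
  (forall w, continuous f w) -> ex_RInt f a b.
Proof. intros H; apply (ex_RInt_continuous (V := R_CompleteNormedModule)); auto. Qed.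

Lemma is_RInt_moment (X : R -> R) (p : nat) :
  (forall w, continuous X w) -> is_RInt (fun w => X w ^ p) 0 1 (moment X p).
Proof.
intros H; apply (RInt_correct (V := R_CompleteNormedModule)), ex_RInt_continuous_R.
intros w; apply continuous_pow, H.
Qed.

Lemma continuous_exp_scal (X : R -> R) (t w : R) :
  continuous X w -> continuous (fun w => exp (t * X w)) w.
Proof.
intros H; apply (continuous_comp (fun w => t * X w) exp).
- exact (continuous_scal_r t X w H).
- apply continuity_pt_filterlim, derivable_continuous_pt, derivable_pt_exp.
Qed.

Lemma is_RInt_sum_f_R0 (f : nat -> R -> R) (l : nat -> R) (a b : R) (n : nat) :
  (forall k, (k <= n)%nat -> is_RInt (f k) a b (l k)) ->
  is_RInt (fun w => sum_f_R0 (fun k => f k w) n) a b (sum_f_R0 l n).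
Proof.
intros H; induction n as [|n IH]; simpl.
- apply H; lia.
- apply (is_RInt_plus (V := R_NormedModule)); [apply IH; intros k Hk; apply H; lia|].
  apply H; lia.
Qed.

(** The exponential series of [t * X w] converges uniformly in [w] because [X] is bounded, so it may
    be integrated term by term. *)
Lemma is_pseries_mgf (X : R -> R) (t : R) :
  bounded_continuous X ->
  is_pseries (fun p => moment X p / INR (fact p)) t (mgf X t).
Proof.
intros [Hc [B HB]].
apply is_pseries_Reals; intros e He.
(* The argument [t * X w] stays within [Rabs t * B]. Half of [e] is used since integration only
   preserves the non-strict bound. *)
destruct (exp_partial_sums_uniform (Rabs t * B) (pos_div_2 (mkposreal e He))) as [N HN].
exists N; intros n Hn; unfold R_dist.
set (s := sum_f_R0 _ n).
assert (Hs : is_RInt (fun w => sum_f_R0 (fun k => / INR (fact k) * (t * X w) ^ k) n) 0 1 s).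
{ apply is_RInt_sum_f_R0; intros k _.
  apply (is_RInt_ext (fun w => scal (t ^ k / INR (fact k)) (X w ^ k))).
  - intros w _; unfold scal; simpl; unfold mult; simpl.
    rewrite Rpow_mult_distr; unfold Rdiv; ring.
  - replace (moment X k / INR (fact k) * t ^ k)
      with (scal (t ^ k / INR (fact k)) (moment X k)).
    + apply (is_RInt_scal (V := R_NormedModule)), is_RInt_moment, Hc.
    + unfold scal; simpl; unfold mult; simpl; unfold Rdiv; ring. }
assert (Hm : is_RInt (fun w => exp (t * X w)) 0 1 (mgf X t)).
{ apply (RInt_correct (V := R_CompleteNormedModule)), ex_RInt_continuous_R.
  intros w; apply continuous_exp_scal, Hc. }
pose proof (is_RInt_minus (V := R_NormedModule) _ _ _ _ _ _ Hs Hm) as Hd.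
apply Rle_lt_trans with ((1 - 0) * (e / 2)); [|lra].
refine (norm_RInt_le_const (V := R_NormedModule) _ 0 1 _ _ _ _ Hd); [lra|].
intros w _; change (Rabs (sum_f_R0 (fun k => / INR (fact k) * (t * X w) ^ k) n - exp (t * X w)) <= e / 2).
rewrite Rabs_minus_sym; apply Rlt_le, HN; [exact Hn|].
rewrite Rabs_mult; apply Rmult_le_compat_l; [apply Rabs_pos|apply HB].
Qed.

Lemma mgf_PSeries (X : R -> R) (t : R) :
  bounded_continuous X -> mgf X t = PSeries (fun p => moment X p / INR (fact p)) t.
Proof. intros H; symmetry; apply is_pseries_unique, is_pseries_mgf, H. Qed.

Lemma CV_radius_mgf (X : R -> R) :
  bounded_continuous X -> CV_radius (fun p => moment X p / INR (fact p)) = p_infty.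
Proof.
intros H; apply CV_radius_entire; intros t; exists (mgf X t); apply is_pseries_mgf, H.
Qed.

Lemma mgf_pos (X : R -> R) (t : R) : bounded_continuous X -> 0 < mgf X t.
Proof.
intros [Hc _]; apply RInt_gt_0; [lra|intros; apply exp_pos|].
intros w _; apply continuous_exp_scal, Hc.
Qed.

Lemma smooth_PSeries_entire (a : nat -> R) : CV_radius a = p_infty -> smooth (PSeries a).
Proof. intros H n x; apply ex_derive_n_PSeries; rewrite H; exact I. Qed.

Lemma smooth_ext (f g : R -> R) : (forall x, f x = g x) -> smooth f -> smooth g.
Proof. intros H Hf n x; apply (ex_derive_n_ext f); auto. Qed.

Lemma smooth_mgf (X : R -> R) : bounded_continuous X -> smooth (mgf X).
Proof.
intros H; apply (smooth_ext (PSeries (fun p => moment X p / INR (fact p)))).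
- intros x; symmetry; apply mgf_PSeries, H.
- apply smooth_PSeries_entire, CV_radius_mgf, H.
Qed.

(** * Additivity of cumulants *)

Lemma bounded_continuous_plus (X Y : R -> R) :
  bounded_continuous X -> bounded_continuous Y ->
  bounded_continuous (fun w => X w + Y w).
Proof.
intros [HX [B HB]] [HY [D HD]]; split.
- intros w; apply (continuous_plus X Y w); auto.
- exists (B + D); intros w; eapply Rle_trans; [apply Rabs_triang|].
  specialize (HB w); specialize (HD w); lra.
Qed.

Lemma moment_plus (X Y : R -> R) (l : nat -> R) (p : nat) :
  (forall i, (i <= p)%nat ->
     is_RInt (fun w => X w ^ i * Y w ^ (p - i)) 0 1 (l i)) ->
  moment (fun w => X w + Y w) p = sum_f_R0 (fun i => Binomial.C p i * l i) p.
Proof.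
intros H; apply is_RInt_unique.
apply (is_RInt_ext (fun w => sum_f_R0 (fun i => Binomial.C p i * (X w ^ i * Y w ^ (p - i))) p)).
- intros w _; rewrite binomial; apply sum_eq; intros i _; ring.
- apply (is_RInt_sum_f_R0 (fun i w => Binomial.C p i * (X w ^ i * Y w ^ (p - i)))).
  intros i Hi; apply (is_RInt_scal (V := R_NormedModule)), H, Hi.
Qed.

(* The right-hand sides are the mixed moments of [X] and an independent copy
   of [Z]; cumulants are additive under independence. *)
Lemma cumulant01_plus (X Y Z : R -> R) (m : nat) :
  bounded_continuous X -> bounded_continuous Y -> bounded_continuous Z ->
  (forall i j, (i + j <= m)%nat ->
     is_RInt (fun w => X w ^ i * Y w ^ j) 0 1 (moment X i * moment Z j)) ->
  cumulant01 (fun w => X w + Y w) m = cumulant01 X m + cumulant01 Z m.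
Proof.
intros HX HY HZ H.
pose proof (bounded_continuous_plus X Y HX HY) as HXY.
pose proof (CV_radius_mgf X HX) as RX; pose proof (CV_radius_mgf Z HZ) as RZ.
set (ax := fun p => moment X p / INR (fact p)) in RX.
set (az := fun p => moment Z p / INR (fact p)) in RZ.
(* The Cauchy product [PS_mult ax az] is the expansion of [mgf X * mgf Z], the moment generating
   function of an independent sum. *)
assert (RM : CV_radius (PS_mult ax az) = p_infty).
{ apply CV_radius_entire; intros x; apply ex_pseries_mult; [rewrite RX|rewrite RZ]; exact I. }
assert (HM : forall t, PSeries (PS_mult ax az) t = mgf X t * mgf Z t).
{ intros t; rewrite PSeries_mult by (rewrite ?RX, ?RZ; exact I).
  rewrite !mgf_PSeries by assumption; reflexivity. }
transitivity (Derive_n (fun t => ln (PSeries (PS_mult ax az) t)) m 0).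
- apply (Derive_n_ln_ext (mgf (fun w => X w + Y w)) (PSeries (PS_mult ax az))).
  + apply smooth_mgf, HXY.
  + intros y; apply mgf_pos, HXY.
  + apply smooth_PSeries_entire, RM.
  + intros y; rewrite HM; apply Rmult_lt_0_compat; apply mgf_pos; assumption.
  (* Only Taylor coefficients up to order [m] are compared: the binomial formula for the moments of
     [X + Y], divided by [i!], is the Cauchy product. *)
  + intros i Hi.
    rewrite (Derive_n_ext _ _ i 0 (fun t => mgf_PSeries (fun w => X w + Y w) t HXY)).
    rewrite !Derive_n_coef; [|rewrite RM; exact I|rewrite CV_radius_mgf by exact HXY; exact I].
    f_equal; unfold PS_mult, ax, az.
    rewrite (moment_plus X Y (fun j => moment X j * moment Z (i - j))).
    * unfold Rdiv at 1; rewrite Rmult_comm, scal_sum.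
      apply sum_eq; intros j Hj; unfold Binomial.C.
      field; repeat split; apply INR_fact_neq_0.
    * intros j Hj; apply H; lia.
- rewrite (Derive_n_ext _ (fun t => ln (mgf X t) + ln (mgf Z t))).
  + apply Derive_n_plus; apply filter_forall; intros y k _;
      apply smooth_ln; try (apply smooth_mgf; assumption); intros; apply mgf_pos; assumption.
  + intros t; rewrite HM; apply ln_mult; apply mgf_pos; assumption.
Qed.

(** * Integer relations of bounded weight *)

Section SmallRelations.

Variables (a : nat -> nat) (eta : R).
Hypothesis Hpos : forall k, (1 <= k)%nat -> (0 < a k)%nat.
Hypothesis Hincr : forall k, (1 <= k)%nat -> (a k < a (S k))%nat.
Hypothesis Heta : 1 < eta.
Hypothesis Htr : transcendental eta.
Hypothesis Hlim : is_lim_seq (fun k => INR (a (S k)) / INR (a k)) eta.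

(* Coefficients are indexed downwards from the largest index [k + 1]: [c j] is
   the coefficient of [a (k + 1 - j)]. *)
Definition combination (c : nat -> Z) (k d : nat) : R :=
  sum_f_R0 (fun j => IZR (c j) * INR (a (S k - j))) d.

Definition weight (c : nat -> Z) (d : nat) : R :=
  sum_f_R0 (fun j => Rabs (IZR (c j))) d.

Lemma a_pos k : (1 <= k)%nat -> 0 < INR (a k).
Proof. intros Hk; apply lt_0_INR, Hpos, Hk. Qed.

Lemma a_monotone i j : (1 <= i)%nat -> (i <= j)%nat -> INR (a i) <= INR (a j).
Proof.
intros Hi Hij; apply le_INR; induction Hij as [|j Hij IH]; [lia|].
pose proof (Hincr j); lia.
Qed.

(** The ratio telescopes into [j] inverse consecutive ratios, each tending to [/ eta]. *)
Lemma is_lim_seq_backward_ratio (j : nat) :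
  is_lim_seq (fun k => INR (a (S k - j)) / INR (a (S k))) (/ eta ^ j).
Proof.
induction j as [|j IH].
- apply (is_lim_seq_ext (fun _ => 1)); [|simpl; rewrite Rinv_1; apply is_lim_seq_const].
  intros k; rewrite Nat.sub_0_r; field.
  apply Rgt_not_eq, a_pos; lia.
- apply is_lim_seq_incr_1.
  apply (is_lim_seq_ext (fun k => INR (a (S k - j)) / INR (a (S k)) * / (INR (a (S (S k))) / INR (a (S k))))).
  + intros k; replace (S (S k) - S j)%nat with (S k - j)%nat by lia.
    field; split; apply Rgt_not_eq, a_pos; lia.
  + replace (/ eta ^ S j) with (/ eta ^ j * / eta) by (simpl; field; split; [apply pow_nonzero|]; lra).
    apply is_lim_seq_mult'; [exact IH|].
    apply (is_lim_seq_inv (fun k => INR (a (S (S k))) / INR (a (S k))) (Finite eta)).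
    * apply (is_lim_seq_incr_1 (fun k => INR (a (S k)) / INR (a k))); exact Hlim.
    * intros H; injection H; lra.
Qed.

Definition limit_value (c : nat -> Z) (d : nat) : R :=
  sum_f_R0 (fun j => IZR (c j) * / eta ^ j) d.

Lemma is_lim_seq_combination (c : nat -> Z) (d : nat) :
  is_lim_seq (fun k => combination c k d / INR (a (S k))) (limit_value c d).
Proof.
unfold combination, limit_value.
assert (H : forall j, is_lim_seq (fun k => IZR (c j) * (INR (a (S k - j)) / INR (a (S k))))
                        (IZR (c j) * / eta ^ j)).
{ intros j; apply is_lim_seq_mult'; [apply is_lim_seq_const|apply is_lim_seq_backward_ratio]. }
induction d as [|d IH]; cbn [sum_f_R0].
- eapply is_lim_seq_ext; [|apply (H 0%nat)]; intros k; cbv beta; unfold Rdiv; ring.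
- eapply is_lim_seq_ext; [|apply is_lim_seq_plus'; [exact IH|apply (H (S d))]].
  intros k; cbv beta; unfold Rdiv; ring.
Qed.

Lemma sum_f_R0_rev (f : nat -> R) (n : nat) :
  sum_f_R0 (fun i => f (n - i)%nat) n = sum_f_R0 f n.
Proof.
induction n as [|n IH]; [reflexivity|].
rewrite decomp_sum by lia; simpl pred.
rewrite (tech5 f n), <- IH, Rplus_comm; f_equal.
Qed.

(** Multiplying by [eta ^ d] and reversing the coefficients turns a zero of this polynomial in
    [/ eta] into an integer polynomial relation for [eta] with leading coefficient [c 0]. *)
Lemma limit_value_nonzero (c : nat -> Z) (d : nat) :
  c 0%nat <> 0%Z -> limit_value c d <> 0.
Proof.
intros Hc H.
apply (Htr d (fun i => c (d - i)%nat)).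
- exists d; split; [lia|]; rewrite Nat.sub_diag; exact Hc.
- change (sum_n (fun i => IZR (c (d - i)%nat) * eta ^ i) d = 0).
  rewrite sum_n_Reals.
  replace 0 with (eta ^ d * limit_value c d) by (rewrite H; ring).
  unfold limit_value; rewrite <- (sum_f_R0_rev (fun j => IZR (c j) * / eta ^ j) d), scal_sum.
  apply sum_eq; intros i Hi.
  replace (eta ^ d) with (eta ^ i * eta ^ (d - i)) by (rewrite <- pow_add; f_equal; lia).
  field; apply pow_nonzero; lra.
Qed.

Lemma combination_tail (c : nat -> Z) (b : nat -> R) (M : R) (G i : nat) :
  (forall j, (G < j <= G + i)%nat -> 0 <= b j <= M) ->
  Rabs (sum_f_R0 (fun j => IZR (c j) * b j) (G + i) - sum_f_R0 (fun j => IZR (c j) * b j) G)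
  <= M * (weight c (G + i) - weight c G).
Proof.
unfold weight; induction i as [|i IH]; intros H.
- rewrite Nat.add_0_r, !Rminus_diag, Rabs_R0; lra.
- rewrite Nat.add_succ_r; simpl sum_f_R0.
  assert (IH' := IH (fun j Hj => H j ltac:(lia))); clear IH.
  destruct (H (S (G + i)) ltac:(lia)) as [Hb0 HbM].
  set (s := sum_f_R0 (fun j => IZR (c j) * b j) (G + i)) in *.
  replace (s + IZR (c (S (G + i))) * b (S (G + i)) - sum_f_R0 (fun j => IZR (c j) * b j) G)
    with ((s - sum_f_R0 (fun j => IZR (c j) * b j) G) + IZR (c (S (G + i))) * b (S (G + i))) by ring.
  eapply Rle_trans; [apply Rabs_triang|].
  rewrite Rabs_mult, (Rabs_pos_eq (b _)) by exact Hb0.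
  pose proof (Rmult_le_compat_l _ _ _ (Rabs_pos (IZR (c (S (G + i))))) HbM).
  lra.
Qed.

Lemma weight_pos c d : 0 <= weight c d.
Proof. apply cond_pos_sum; intros; apply Rabs_pos. Qed.

Lemma weight_monotone c d e : (d <= e)%nat -> weight c d <= weight c e.
Proof.
intros H; induction H as [|e H IH]; [lra|].
unfold weight in *; simpl; pose proof (Rabs_pos (IZR (c (S e)))); lra.
Qed.

Lemma weight_ext c c' d :
  (forall j, (j <= d)%nat -> c j = c' j) -> weight c d = weight c' d.
Proof. intros H; apply sum_eq; intros j Hj; rewrite H; auto. Qed.

(** [p] prescribes the coefficients at positions 0 to [d]; the threshold [K] has to serve all
    continuations [c] of weight at most [W] at once. *)
Definition nonvanishing (W : R) (d : nat) (p : nat -> Z) : Prop :=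
  exists K, forall k c, (K <= k)%nat ->
    (forall j, (j <= d)%nat -> c j = p j) -> weight c k <= W ->
    combination c k k <> 0.

(** Relative to [a (k + 1)], the prescribed part tends to a nonzero limit of modulus [L], while
    everything beyond a block of zeros reaching to [G] is asymptotically at most [W * / eta ^ G]. A
    large [G] makes the former dominate. *)
Lemma nonvanishing_far (W : R) (d : nat) (p : nat -> Z) :
  0 <= W -> p 0%nat <> 0%Z ->
  exists G, (d <= G)%nat /\
    nonvanishing W G (fun j => if (j <=? d)%nat then p j else 0%Z).
Proof.
intros HW Hp.
pose proof (limit_value_nonzero p d Hp) as HL; apply Rabs_pos_lt in HL.
set (L := Rabs (limit_value p d)) in *.

assert (HG : exists G, (d <= G)%nat /\ W * / eta ^ G < L).
{ assert (H0 : is_lim_seq (fun G => W * (/ eta) ^ G) (W * 0)).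
  { apply is_lim_seq_mult'; [apply is_lim_seq_const|apply is_lim_seq_geom].
    rewrite Rabs_pos_eq by (apply Rlt_le, Rinv_0_lt_compat; lra).
    rewrite <- Rinv_1; apply Rinv_lt_contravar; lra. }
  apply is_lim_seq_spec in H0; destruct (H0 (mkposreal L HL)) as [N HN].
  exists (Nat.max d N); split; [lia|].
  specialize (HN (Nat.max d N) ltac:(lia)); simpl in HN.
  rewrite pow_inv, Rmult_0_r, Rminus_0_r in HN.
  exact (Rle_lt_trans _ _ _ (Rle_abs _) HN). }
destruct HG as [G [HdG HG]]; exists G; split; [exact HdG|].
assert (Hev : is_lim_seq (fun k => Rabs (combination p k d / INR (a (S k)))
                - W * (INR (a (S k - G)) / INR (a (S k)))) (L - W * / eta ^ G)).
{ apply is_lim_seq_minus'.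
  - apply (is_lim_seq_abs _ (Finite _)), is_lim_seq_combination.
  - apply is_lim_seq_mult'; [apply is_lim_seq_const|apply is_lim_seq_backward_ratio]. }
apply is_lim_seq_spec in Hev.
assert (Hgap : 0 < L - W * / eta ^ G) by lra.
(* Taking the limit itself as tolerance makes the sequence positive from [N] on. *)
destruct (Hev (mkposreal _ Hgap)) as [N HN].
(* [k >= G] keeps the index [S k - G] at least 1, where positivity and monotonicity of [a] hold. *)
exists (Nat.max N G); intros k c Hk Hc Hw H0.
specialize (HN k ltac:(lia)); cbn [pos] in HN; apply Rabs_def2 in HN; destruct HN as [_ HN].
assert (HkG : (1 <= S k - G)%nat) by lia.
assert (Hak : 0 < INR (a (S k))) by (apply a_pos; lia).
assert (Hcomb : combination c k G = combination p k d).
{ unfold combination; replace G with (d + (G - d))%nat by lia.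
  assert (Hz : forall i, (d + i <= G)%nat ->
    sum_f_R0 (fun j => IZR (c j) * INR (a (S k - j))) (d + i)
    = sum_f_R0 (fun j => IZR (p j) * INR (a (S k - j))) d).
  { induction i as [|i IH]; intros Hi.
    - rewrite Nat.add_0_r; apply sum_eq; intros j Hj; rewrite Hc by lia.
      rewrite (proj2 (Nat.leb_le j d) Hj); reflexivity.
    - rewrite Nat.add_succ_r; cbn [sum_f_R0]; rewrite IH by lia.
      rewrite Hc by lia.
      rewrite (proj2 (Nat.leb_gt (S (d + i)) d)) by lia; ring. }
  apply Hz; lia. }
pose proof (combination_tail c (fun j => INR (a (S k - j))) (INR (a (S k - G))) G (k - G)) as Ht.
replace (G + (k - G))%nat with k in Ht by lia.
fold (combination c k k) in Ht; fold (combination c k G) in Ht.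
(* If the whole combination vanishes, the tail is the negative of the prescribed part, so the tail
   estimate bounds that part and contradicts [HN]. *)
rewrite H0, Hcomb, Rminus_0_l, Rabs_Ropp in Ht.
assert (Hb : Rabs (combination p k d) <= INR (a (S k - G)) * W).
{ eapply Rle_trans; [apply Ht|].
  - intros j Hj; split; [apply pos_INR|apply a_monotone; lia].
  - apply Rmult_le_compat_l; [apply pos_INR|].
    pose proof (weight_pos c G); lra. }
unfold Rdiv in HN; rewrite Rabs_mult, (Rabs_pos_eq (/ _)) in HN
  by (apply Rlt_le, Rinv_0_lt_compat, Hak).
apply (Rmult_le_compat_r (/ INR (a (S k)))) in Hb; [|apply Rlt_le, Rinv_0_lt_compat, Hak].
lra.
Qed.

(** Only finitely many [z] are concerned, so the largest of their thresholds works; the induction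
    adds the two values of modulus [B + 1]. *)
Lemma uniform_threshold (Q : Z -> nat -> Prop) (B : nat) :
  (forall z, exists K, forall k, (K <= k)%nat -> Q z k) ->
  exists K, forall z k, (Z.abs z <= Z.of_nat B)%Z -> (K <= k)%nat -> Q z k.
Proof.
intros H; induction B as [|B [K HK]].
- destruct (H 0%Z) as [K HK]; exists K; intros z k Hz Hk.
  replace z with 0%Z by lia; auto.
- destruct (H (Z.of_nat (S B))) as [K1 HK1], (H (- Z.of_nat (S B))%Z) as [K2 HK2].
  exists (Nat.max K (Nat.max K1 K2)); intros z k Hz Hk.
  destruct (Z.eq_dec z (Z.of_nat (S B))) as [->|H1]; [apply HK1; lia|].
  destruct (Z.eq_dec z (- Z.of_nat (S B))) as [->|H2]; [apply HK2; lia|].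
  apply HK; lia.
Qed.

Lemma coefficient_bound (c : nat -> Z) (B j k : nat) :
  (j <= k)%nat -> weight c k <= INR B -> (Z.abs (c j) <= Z.of_nat B)%Z.
Proof.
intros Hj Hw; apply le_IZR; rewrite abs_IZR, <- INR_IZR_INZ.
eapply Rle_trans; [|exact Hw]; eapply Rle_trans; [|exact (weight_monotone c j k Hj)].
destruct j as [|j]; unfold weight; simpl; [lra|].
pose proof (weight_pos c j) as H; unfold weight in H; lra.
Qed.

(* Each nonzero coefficient beyond the prescribed window uses up at least one unit
   of the budget [w]; if there is none before the index [G] of
   [nonvanishing_far], the prescribed part dominates. *)
Lemma nonvanishing_within_budget (B w : nat) : forall d p,
  p 0%nat <> 0%Z -> INR B < weight p d + INR w -> nonvanishing (INR B) d p.
Proof.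
induction w as [|w IH]; intros d p Hp Hw.
(* With no budget left, the prefix alone already weighs more than [B], so no admissible [c]
   exists. *)
- exists d; intros k c Hk Hc HcW; exfalso.
  pose proof (weight_monotone c d k Hk); rewrite (weight_ext c p d Hc) in H.
  simpl in Hw; lra.
- destruct (nonvanishing_far (INR B) d p (pos_INR B) Hp) as [G [HdG HG]].
  set (p0 := fun j => if (j <=? d)%nat then p j else 0%Z) in *.
  assert (Hp0 : forall j, (j <= d)%nat -> p0 j = p j).
  { intros j Hj; unfold p0; rewrite (proj2 (Nat.leb_le j d) Hj); reflexivity. }
  (* The zeros imposed between [d] and [G] are released one at a time, starting from the last. *)
  assert (Hdown : forall i, (i <= G - d)%nat -> nonvanishing (INR B) (G - i) p0).
  { induction i as [|i IHi]; intros Hi; [rewrite Nat.sub_0_r; exact HG|].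
    destruct (IHi ltac:(lia)) as [K1 HK1].
    set (e := (G - S i)%nat) in *.
    assert (He : (G - i)%nat = S e) by lia; rewrite He in HK1.
    (* A nonzero value [z] of the released coefficient is one of finitely many. Appending it to the
       prefix adds at least 1 to the weight, so the outer induction applies with budget [w]. *)
    destruct (uniform_threshold (fun z k => z <> 0%Z -> forall c,
        (forall j, (j <= e)%nat -> c j = p0 j) -> c (S e) = z ->
        weight c k <= INR B -> combination c k k <> 0) B) as [K2 HK2].
    { intros z; destruct (Z.eq_dec z 0) as [->|Hz]; [exists 0%nat; tauto|].
      set (pz := fun j => if (j <=? e)%nat then p0 j else z).
      destruct (IH (S e) pz) as [K HK].
      - exact Hp.
      - assert (Hwz : weight pz (S e) = weight p0 e + Rabs (IZR z)).
        { unfold weight; cbn [sum_f_R0]; f_equal.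
          - apply sum_eq; intros j Hj; unfold pz.
            rewrite (proj2 (Nat.leb_le j e) Hj); reflexivity.
          - unfold pz; rewrite (proj2 (Nat.leb_gt (S e) e)) by lia; reflexivity. }
        assert (Hz1 : 1 <= Rabs (IZR z)) by (rewrite <- abs_IZR; apply IZR_le; lia).
        pose proof (weight_monotone p0 d e ltac:(lia)) as Hmono.
        rewrite (weight_ext p0 p d Hp0) in Hmono.
        rewrite S_INR in Hw; lra.
      - exists K; intros k Hk _ c Hc Hcz HcW; apply (HK k c Hk); [|exact HcW].
        intros j Hj; unfold pz; destruct (Nat.leb_spec j e); [auto|].
        replace j with (S e) by lia; exact Hcz. }
    exists (Nat.max (S e) (Nat.max K1 K2)); intros k c Hk Hc HcW.
    (* A zero coefficient falls under the longer prescribed window, a nonzero one under the smaller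
       budget. *)
    destruct (Z.eq_dec (c (S e)) 0) as [Hz|Hz].
    - apply HK1; [lia| |exact HcW].
      intros j Hj; destruct (Nat.eq_dec j (S e)) as [->|]; [|apply Hc; lia].
      rewrite Hz; unfold p0; rewrite (proj2 (Nat.leb_gt (S e) d)) by lia; reflexivity.
    - apply (HK2 (c (S e)) k); auto; [|lia].
      apply (coefficient_bound c B (S e) k); [lia|exact HcW]. }
  destruct (Hdown (G - d)%nat (le_n _)) as [K HK].
  exists K; intros k c Hk Hc HcW; apply (HK k c Hk); [|exact HcW].
  intros j Hj; rewrite Hp0 by lia; apply Hc; lia.
Qed.

Lemma no_small_relations (B : nat) :
  exists K, forall k c, (K <= k)%nat -> c 0%nat <> 0%Z ->
    weight c k <= INR B -> combination c k k <> 0.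
Proof.
destruct (uniform_threshold (fun z k => z <> 0%Z -> forall c,
  c 0%nat = z -> weight c k <= INR B -> combination c k k <> 0) B) as [K HK].
- intros z; destruct (Z.eq_dec z 0) as [->|Hz]; [exists 0%nat; tauto|].
  (* Only the leading coefficient is prescribed, and a budget of [B + 1] exceeds [B] whatever its
     weight. *)
  destruct (nonvanishing_within_budget B (S B) 0 (fun _ => z)) as [K HK].
  + exact Hz.
  + pose proof (weight_pos (fun _ => z) 0); rewrite S_INR; lra.
  + exists K; intros k Hk _ c Hc; apply HK; [exact Hk|].
    intros j Hj; replace j with 0%nat by lia; exact Hc.
- exists K; intros k c Hk Hc Hw; apply (HK (c 0%nat) k); auto.
  apply (coefficient_bound c B 0 k); [lia|exact Hw].
Qed.

End SmallRelations.

(** * The arcsine law *)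

Lemma cos_mult_cos (x y : R) : cos x * cos y = (cos (x + y) + cos (x - y)) / 2.
Proof. rewrite cos_plus, cos_minus; field. Qed.

Lemma continuous_cos_scal (u w : R) : continuous (fun w => cos (u * w)) w.
Proof.
apply (ex_derive_continuous (K := R_AbsRing) (V := R_NormedModule)).
auto_derive; exact I.
Qed.

Lemma sin_2PI_Z (b : Z) : sin (2 * PI * IZR b) = 0.
Proof. apply sin_eq_0_1; exists (2 * b)%Z; rewrite mult_IZR; ring. Qed.

Lemma is_RInt_cos_zero (b : Z) :
  b <> 0%Z -> is_RInt (fun w => cos (2 * PI * IZR b * w)) 0 1 0.
Proof.
intros Hb.
assert (Hu : IZR b <> 0 /\ PI <> 0) by (split; [apply not_0_IZR, Hb|apply PI_neq0]).
evar_last.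
- apply (is_RInt_derive (V := R_CompleteNormedModule) (fun w => sin (2 * PI * IZR b * w) / (2 * PI * IZR b))).
  + intros x _; auto_derive; [exact I|field; exact Hu].
  + intros x _; apply continuous_cos_scal.
- unfold minus, plus, opp; simpl.
  rewrite Rmult_1_r, Rmult_0_r, sin_0, sin_2PI_Z; field; exact Hu.
Qed.

(* Wallis' recursion, from the derivative of [cos^(q+1) * sin]. *)
Lemma moment_cos_rec (q : nat) :
  INR (q + 2) * moment (fun w => cos (2 * PI * w)) (q + 2)
  = INR (q + 1) * moment (fun w => cos (2 * PI * w)) q.
Proof.
assert (Hc : forall w, continuous (fun w => cos (2 * PI * w)) w)
  by (intros; apply continuous_cos_scal).
pose proof PI_RGT_0 as HPI.
set (g := fun w => cos (2 * PI * w)) in *.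
assert (H0 : is_RInt (fun w => 2 * PI * (INR (q + 2) * g w ^ (q + 2) - INR (q + 1) * g w ^ q)) 0 1 0).
{ evar_last.
  - apply (is_RInt_derive (V := R_CompleteNormedModule) (fun w => g w ^ (q + 1) * sin (2 * PI * w))).
    + intros x _; unfold g; auto_derive; [exact I|].
      replace (Nat.pred (q + 1)) with q by lia.
      rewrite !pow_add, !plus_INR.
      pose proof (sin2_cos2 (2 * PI * x)) as Hsc; unfold Rsqr in Hsc; simpl.
      set (s := sin (2 * PI * x)) in *; set (c := cos (2 * PI * x)) in *.
      assert (Hs : s * s = 1 - c * c) by lra.
      ring_simplify; replace (s ^ 2) with (1 - c * c) by (rewrite <- Hs; ring).
      ring.
    + intros x _; apply (continuous_scal_r (V := R_NormedModule)).
      apply (continuous_minus (V := R_NormedModule));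
        apply (continuous_scal_r (V := R_NormedModule)), continuous_pow, Hc.
  - unfold minus, plus, opp; simpl.
    replace (2 * PI * 1) with (2 * PI) by ring.
    rewrite Rmult_0_r, sin_0, sin_2PI; ring. }
assert (H1 : is_RInt (fun w => 2 * PI * (INR (q + 2) * g w ^ (q + 2) - INR (q + 1) * g w ^ q)) 0 1
   (2 * PI * (INR (q + 2) * moment g (q + 2) - INR (q + 1) * moment g q))).
{ apply (is_RInt_scal (V := R_NormedModule)).
  apply (is_RInt_minus (V := R_NormedModule));
    apply (is_RInt_scal (V := R_NormedModule)), is_RInt_moment, Hc. }
apply (is_RInt_unique (V := R_CompleteNormedModule)) in H0; apply (is_RInt_unique (V := R_CompleteNormedModule)) in H1; rewrite H0 in H1.
symmetry in H1; apply Rmult_integral in H1; destruct H1; lra.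
Qed.

Lemma moment_cos_odd (j : nat) : moment (fun w => cos (2 * PI * w)) (2 * j + 1) = 0.
Proof.
induction j as [|j IH].
- apply is_RInt_unique, (is_RInt_ext (fun w => cos (2 * PI * IZR 1 * w))).
  + intros w _; simpl; rewrite !Rmult_1_r; reflexivity.
  + apply is_RInt_cos_zero; lia.
- pose proof (moment_cos_rec (2 * j + 1)) as H.
  rewrite IH, Rmult_0_r in H; apply Rmult_integral in H; destruct H as [H|H].
  + exfalso; revert H; apply not_0_INR; lia.
  + rewrite <- H; f_equal; lia.
Qed.

(** The right-hand side is the coefficient of [t ^ (2 * j)] in [I0]. Wallis' recursion divides the
    left-hand side by [(2 * j + 2) ^ 2], which is [4 * (j + 1) ^ 2], at each step. *)
Lemma moment_cos_even (j : nat) :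
  moment (fun w => cos (2 * PI * w)) (2 * j) / INR (fact (2 * j))
  = / (4 ^ j * INR (fact j) ^ 2).
Proof.
induction j as [|j IH].
- unfold moment; simpl; rewrite RInt_const; unfold scal; simpl; unfold mult; simpl; field.
- pose proof (moment_cos_rec (2 * j)) as H.
  replace (2 * S j)%nat with (2 * j + 2)%nat by lia.
  assert (HF : INR (fact (2 * j + 2)) = INR (2 * j + 2) * (INR (2 * j + 1) * INR (fact (2 * j)))).
  { rewrite <- !mult_INR; f_equal.
    replace (2 * j + 2)%nat with (S (S (2 * j))) by lia.
    replace (2 * j + 1)%nat with (S (2 * j)) by lia; reflexivity. }
  assert (Hs : INR (fact (S j)) = INR (S j) * INR (fact j)) by (rewrite <- mult_INR; reflexivity).
  assert (N1 : INR (2 * j + 2) <> 0) by (apply not_0_INR; lia).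
  assert (N2 : INR (2 * j + 1) <> 0) by (apply not_0_INR; lia).
  assert (N3 : INR (S j) <> 0) by (apply not_0_INR; lia).
  pose proof (INR_fact_neq_0 j) as N4; pose proof (INR_fact_neq_0 (2 * j)) as N5.
  assert (N6 : 4 ^ j <> 0) by (apply pow_nonzero; lra).
  assert (E : INR (2 * j + 2) = 2 * INR (S j))
    by (change 2 with (INR 2); rewrite <- mult_INR; f_equal; lia).
  set (M := moment _ (2 * j + 2)) in *.
  assert (HM : M = INR (2 * j + 1) * moment (fun w => cos (2 * PI * w)) (2 * j) / INR (2 * j + 2))
    by (rewrite <- H; field; exact N1).
  rewrite HM, HF, Hs.
  transitivity (moment (fun w => cos (2 * PI * w)) (2 * j) / INR (fact (2 * j)) / INR (2 * j + 2) ^ 2).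
  { field; auto. }
  rewrite IH, E; simpl pow; field; auto.
Qed.

Lemma bounded_continuous_cos (u : R) : bounded_continuous (fun w => cos (u * w)).
Proof.
split; [intros w; apply continuous_cos_scal|].
exists 1; intros w; apply Rabs_le; split; apply COS_bound.
Qed.

Lemma I0_mgf (t : R) : I0 t = mgf (fun w => cos (2 * PI * w)) t.
Proof.
pose proof (bounded_continuous_cos (2 * PI)) as Hb.
rewrite mgf_PSeries by exact Hb.
set (m := fun p => moment (fun w => cos (2 * PI * w)) p / INR (fact p)).
assert (Hodd : forall n, m (2 * n + 1)%nat = 0).
{ intros n; unfold m; rewrite moment_cos_odd; unfold Rdiv; ring. }
assert (HI : forall n, m (2 * n)%nat * (t ^ 2) ^ n = (t / 2) ^ (2 * n) / INR (fact n) ^ 2).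
{ intros n; unfold m; rewrite moment_cos_even.
  rewrite (pow_mult (t / 2)).
  replace ((t / 2) ^ 2) with (t ^ 2 * / 4) by field.
  rewrite Rpow_mult_distr, pow_inv; field.
  split; [apply pow_nonzero; lra|apply INR_fact_neq_0]. }
rewrite PSeries_odd_even.
- rewrite (PSeries_ext (fun n => m (2 * n + 1)%nat) (fun _ => 0)) by exact Hodd.
  rewrite PSeries_const_0, Rmult_0_r, Rplus_0_r.
  symmetry; apply Series_ext, HI.
(* Splitting into even and odd parts requires both to converge; the even part is dominated by the
   series of [exp (t ^ 2)]. *)
- apply (ex_series_le (V := R_CompleteNormedModule) _ (fun n => scal (pow_n (t ^ 2) n) (/ INR (fact n)))).
  + intros n; unfold norm, scal; simpl; unfold abs, mult; simpl; fold (t ^ 2).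
    rewrite pow_n_pow; replace (t * (t * 1)) with (t ^ 2) by (simpl; ring).
    pose proof (pow_le (t ^ 2) n (pow2_ge_0 t)) as Ht.
    replace (n + (n + 0))%nat with (2 * n)%nat by lia.
    unfold m; rewrite moment_cos_even.
    pose proof (INR_fact_lt_0 n) as Hf.
    assert (Hf1 : 1 <= INR (fact n)) by (apply (le_INR 1), lt_O_fact).
    assert (H4 : 1 <= 4 ^ n) by (apply pow_R1_Rle; lra).
    assert (Hd : INR (fact n) <= 4 ^ n * INR (fact n) ^ 2) by nra.
    rewrite Rabs_pos_eq.
    * apply Rmult_le_compat_l; [exact Ht|apply Rinv_le_contravar; assumption].
    * apply Rmult_le_pos; [exact Ht|apply Rlt_le, Rinv_0_lt_compat; lra].
  + exists (exp (t ^ 2)); apply is_exp_Reals.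
- apply (ex_pseries_ext (fun _ => 0)); [intros; symmetry; apply Hodd|].
  apply CV_radius_inside; rewrite CV_radius_const_0; exact I.
Qed.

Lemma arcsine_cumulant_cos (m : nat) :
  arcsine_cumulant m = cumulant01 (fun w => cos (2 * PI * w)) m.
Proof. apply Derive_n_ext; intros t; rewrite I0_mgf; reflexivity. Qed.

(** * Sums of cosines with integer frequencies *)

Lemma bounded_continuous_S_n (a : nat -> nat) (n : nat) : bounded_continuous (S_n a n).
Proof.
unfold S_n; induction n as [|n [IHc [B IHB]]].
- split; [intros w|exists 0; intros w].
  + apply (continuous_ext (fun _ => 0)); [|apply continuous_const].
    intros x; rewrite sum_n_m_zero by lia; reflexivity.
  + rewrite sum_n_m_zero by lia; change (Rabs 0 <= 0); rewrite Rabs_R0; lra.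
- destruct (bounded_continuous_cos (2 * PI * INR (a (S n)))) as [Hc [D HD]]; split.
  + intros w.
    apply (continuous_ext (fun w => sum_n_m (fun k => cos (2 * PI * INR (a k) * w)) 1 n
                                   + cos (2 * PI * INR (a (S n)) * w))).
    * intros x; rewrite sum_n_Sm by lia; reflexivity.
    * apply (continuous_plus (V := R_NormedModule)); [apply IHc|apply Hc].
  + exists (B + D); intros w; rewrite sum_n_Sm by lia.
    eapply Rle_trans; [apply Rabs_triang|]; specialize (IHB w); specialize (HD w); lra.
Qed.

Lemma S_n_succ (a : nat -> nat) (n : nat) (w : R) :
  S_n a (S n) w = S_n a n w + cos (2 * PI * INR (a (S n)) * w).
Proof. unfold S_n; rewrite sum_n_Sm by lia; reflexivity. Qed.

Lemma is_RInt_mult_S_n_zero (a : nat -> nat) (f : R -> R) (n : nat) :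
  (forall i, (1 <= i <= n)%nat ->
     is_RInt (fun w => f w * cos (2 * PI * INR (a i) * w)) 0 1 0) ->
  is_RInt (fun w => f w * S_n a n w) 0 1 0.
Proof.
induction n as [|n IH]; intros H.
- apply (is_RInt_ext (fun _ => 0)).
  + intros w _; unfold S_n; rewrite sum_n_m_zero by lia.
    symmetry; apply Rmult_0_r.
  + evar_last; [apply (is_RInt_const (V := R_NormedModule))|].
    apply Rmult_0_r.
- apply (is_RInt_ext (fun w => plus (f w * S_n a n w) (f w * cos (2 * PI * INR (a (S n)) * w)))).
  + intros w _; rewrite S_n_succ; unfold plus; simpl; ring.
  + replace 0 with (plus 0 0) at 2 by apply Rplus_0_r.
    apply (is_RInt_plus (V := R_NormedModule)); [apply IH|apply H; lia].
    intros i Hi; apply H; lia.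
Qed.

(** * Asymptotic decorrelation *)

(** Multiplying by one more cosine shifts a frequency by plus or minus some [a i]; [add_at] records
    this shift in the coefficients. *)
Definition add_at (c : nat -> Z) (i : nat) (s : Z) (j : nat) : Z :=
  if Nat.eq_dec j i then (c j + s)%Z else c j.

Lemma combination_add_at (a : nat -> nat) (c : nat -> Z) (i : nat) (s : Z) (k d : nat) :
  (i <= d)%nat ->
  combination a (add_at c i s) k d = combination a c k d + IZR s * INR (a (S k - i)%nat).
Proof.
unfold combination; intros Hi.
assert (Hlt : forall e, (e < i)%nat ->
  sum_f_R0 (fun j => IZR (add_at c i s j) * INR (a (S k - j)%nat)) e
  = sum_f_R0 (fun j => IZR (c j) * INR (a (S k - j)%nat)) e).
{ intros e He; apply sum_eq; intros j Hj; unfold add_at.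
  destruct (Nat.eq_dec j i); [lia|reflexivity]. }
induction Hi as [|d Hi IH].
- destruct i as [|i].
  + simpl; unfold add_at; simpl; rewrite plus_IZR; ring.
  + cbn [sum_f_R0]; rewrite Hlt by lia; unfold add_at.
    destruct (Nat.eq_dec (S i) (S i)); [rewrite plus_IZR; ring|lia].
- cbn [sum_f_R0]; rewrite IH; unfold add_at.
  destruct (Nat.eq_dec (S d) i); [lia|ring].
Qed.

Lemma weight_add_at (c : nat -> Z) (i : nat) (s : Z) (d : nat) :
  weight (add_at c i s) d <= weight c d + Rabs (IZR s).
Proof.
unfold weight.
assert (Hlt : forall e, (e < i)%nat ->
  sum_f_R0 (fun j => Rabs (IZR (add_at c i s j))) e = sum_f_R0 (fun j => Rabs (IZR (c j))) e).
{ intros e He; apply sum_eq; intros j Hj; unfold add_at.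
  destruct (Nat.eq_dec j i); [lia|reflexivity]. }
pose proof (Rabs_pos (IZR s)) as Hs.
assert (Hstep : Rabs (IZR (c i + s)) <= Rabs (IZR (c i)) + Rabs (IZR s))
  by (rewrite plus_IZR; apply Rabs_triang).
induction d as [|d IH].
- simpl; unfold add_at; destruct (Nat.eq_dec 0 i) as [<-|]; lra.
- cbn [sum_f_R0]; unfold add_at at 2; destruct (Nat.eq_dec (S d) i) as [<-|]; [|lra].
  rewrite Hlt by lia; lra.
Qed.

Section Decorrelation.

Variables (a : nat -> nat) (k B : nat).
Hypothesis Hrel : forall c, c 0%nat <> 0%Z -> weight c k <= INR B -> combination a c k k <> 0.

(** Product-to-sum formulas absorb the factors of the power one by one into the frequency. Each
    costs at most one unit of weight and leaves [c 0] unchanged, so [Hrel] keeps every final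
    frequency nonzero. *)
Lemma S_n_pow_orthogonal (r : nat) : forall b c,
  IZR b = combination a c k k -> c 0%nat <> 0%Z -> weight c k + INR r <= INR B ->
  is_RInt (fun w => S_n a k w ^ r * cos (2 * PI * IZR b * w)) 0 1 0.
Proof.
induction r as [|r IH]; intros b c Hb Hc Hw.
- apply (is_RInt_ext (fun w => cos (2 * PI * IZR b * w))).
  + intros w _; simpl; symmetry; apply Rmult_1_l.
  + apply is_RInt_cos_zero; intros ->.
    apply (Hrel c Hc); [simpl in Hw; lra|symmetry; exact Hb].
- apply (is_RInt_ext (fun w => S_n a k w ^ r * cos (2 * PI * IZR b * w) * S_n a k w)).
  { intros w _; simpl; ring. }
  apply is_RInt_mult_S_n_zero; intros i Hi.
  assert (Hs : forall s, Rabs (IZR s) = 1 ->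
    is_RInt (fun w => S_n a k w ^ r * cos (2 * PI * IZR (b + s * Z.of_nat (a i)) * w)) 0 1 0).
  { intros s Hs; apply (IH _ (add_at c (S k - i) s)).
    - rewrite combination_add_at by lia.
      rewrite plus_IZR, mult_IZR, <- INR_IZR_INZ, Hb.
      replace (S k - (S k - i))%nat with i by lia; reflexivity.
    (* Since [i <= k], the position [S k - i] is at least 1 and the leading coefficient survives. *)
    - unfold add_at; destruct (Nat.eq_dec 0 (S k - i)); [lia|exact Hc].
    - pose proof (weight_add_at c (S k - i) s k); rewrite S_INR in Hw; lra. }
  pose proof (Hs 1%Z ltac:(rewrite Rabs_pos_eq; lra)) as H1.
  pose proof (Hs (-1)%Z ltac:(rewrite Rabs_left; lra)) as H2.
  pose proof (is_RInt_scal (V := R_NormedModule) _ _ _ (/ 2) _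
    (is_RInt_plus (V := R_NormedModule) _ _ _ _ _ _ H1 H2)) as H3.
  evar_last; [eapply is_RInt_ext; [|exact H3]|].
  + intros w _.
    change (/ 2 * (S_n a k w ^ r * cos (2 * PI * IZR (b + 1 * Z.of_nat (a i)) * w)
                   + S_n a k w ^ r * cos (2 * PI * IZR (b + -1 * Z.of_nat (a i)) * w))
            = S_n a k w ^ r * cos (2 * PI * IZR b * w) * cos (2 * PI * INR (a i) * w)).
    rewrite (Rmult_assoc (S_n a k w ^ r)), cos_mult_cos.
    rewrite !plus_IZR, !mult_IZR, <- INR_IZR_INZ.
    replace (2 * PI * (IZR b + 1 * INR (a i)) * w)
      with (2 * PI * IZR b * w + 2 * PI * INR (a i) * w) by ring.
    replace (2 * PI * (IZR b + -1 * INR (a i)) * w)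
      with (2 * PI * IZR b * w - 2 * PI * INR (a i) * w) by ring.
    field.
  + unfold scal, plus; simpl; unfold mult; simpl; ring.
Qed.

Definition single (z : Z) (j : nat) : Z := if Nat.eq_dec j 0 then z else 0%Z.

Lemma combination_single (z : Z) (d : nat) :
  combination a (single z) k d = IZR z * INR (a (S k)).
Proof.
unfold combination; induction d as [|d IH].
- simpl; reflexivity.
- cbn [sum_f_R0]; rewrite IH; unfold single; simpl; ring.
Qed.

Lemma weight_single (z : Z) (d : nat) : weight (single z) d = Rabs (IZR z).
Proof.
unfold weight; induction d as [|d IH]; [reflexivity|].
cbn [sum_f_R0]; rewrite IH; unfold single; simpl; rewrite Rabs_R0; ring.
Qed.

(** The additional factor with frequency [z] makes the induction on [q] close: each factor of the
    power moves [z] by plus or minus 1, identically in both integrals. At [q = 0] both reduce to the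
    constant case or, for [z <> 0], to vanishing integrals. *)
Lemma S_n_pow_decorrelated (r q : nat) : forall z : Z,
  INR r + INR q + Rabs (IZR z) <= INR B ->
  exists l,
    is_RInt (fun w => cos (2 * PI * w) ^ q * cos (IZR z * (2 * PI * w))) 0 1 l /\
    is_RInt (fun w => S_n a k w ^ r * (cos (2 * PI * INR (a (S k)) * w) ^ q
                      * cos (IZR z * (2 * PI * INR (a (S k)) * w)))) 0 1
            (moment (S_n a k) r * l).
Proof.
induction q as [|q IH]; intros z Hz.
- destruct (Z.eq_dec z 0) as [->|Hz0].
  + exists 1; split.
    * apply (is_RInt_ext (fun _ => 1)).
      { intros w _; rewrite Rmult_0_l, cos_0; simpl; ring. }
      evar_last; [apply (is_RInt_const (V := R_NormedModule))|].
      unfold scal; simpl; unfold mult; simpl; ring.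
    * rewrite Rmult_1_r; apply (is_RInt_ext (fun w => S_n a k w ^ r)).
      { intros w _; rewrite Rmult_0_l, cos_0; simpl; ring. }
      apply is_RInt_moment, bounded_continuous_S_n.
  + exists 0; split.
    * apply (is_RInt_ext (fun w => cos (2 * PI * IZR z * w))).
      { intros w _; simpl; rewrite Rmult_1_l; f_equal; ring. }
      apply is_RInt_cos_zero, Hz0.
    * rewrite Rmult_0_r.
      apply (is_RInt_ext (fun w => S_n a k w ^ r * cos (2 * PI * IZR (z * Z.of_nat (a (S k))) * w))).
      { intros w _; rewrite mult_IZR, <- INR_IZR_INZ; simpl; rewrite Rmult_1_l.
        f_equal; f_equal; ring. }
      apply (S_n_pow_orthogonal r _ (single z)).
      -- rewrite combination_single, mult_IZR, <- INR_IZR_INZ; reflexivity.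
      -- exact Hz0.
      -- rewrite weight_single; simpl in Hz; lra.
- rewrite S_INR in Hz.
  assert (Hstep : forall s, Rabs (IZR s) = 1 -> INR r + INR q + Rabs (IZR (z + s)) <= INR B).
  { intros s Hs; rewrite plus_IZR; pose proof (Rabs_triang (IZR z) (IZR s)); lra. }
  destruct (IH (z + 1)%Z) as [l1 [A1 B1]]; [apply Hstep; rewrite Rabs_pos_eq; lra|].
  destruct (IH (z + -1)%Z) as [l2 [A2 B2]]; [apply Hstep; rewrite Rabs_left; lra|].
  assert (Hcos : forall x, cos x * cos (IZR z * x)
            = / 2 * (cos (IZR (z + 1) * x) + cos (IZR (z + -1) * x))).
  { intros x; rewrite Rmult_comm, cos_mult_cos, !plus_IZR.
    replace ((IZR z + 1) * x) with (IZR z * x + x) by ring.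
    replace ((IZR z + -1) * x) with (IZR z * x - x) by ring.
    field. }
  exists (/ 2 * (l1 + l2)); split.
  + eapply is_RInt_ext; [|exact (is_RInt_scal (V := R_NormedModule) _ _ _ (/ 2) _
      (is_RInt_plus (V := R_NormedModule) _ _ _ _ _ _ A1 A2))].
    intros w _; unfold scal, plus; simpl; unfold mult; simpl.
    set (u := cos (2 * PI * w) ^ q).
    transitivity (u * (cos (2 * PI * w) * cos (IZR z * (2 * PI * w)))); [rewrite Hcos; ring|ring].
  + evar_last; [eapply is_RInt_ext; [|exact (is_RInt_scal (V := R_NormedModule) _ _ _ (/ 2) _
      (is_RInt_plus (V := R_NormedModule) _ _ _ _ _ _ B1 B2))]|].
    * intros w _; unfold scal, plus; simpl; unfold mult; simpl.
      set (x := 2 * PI * INR (a (S k)) * w).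
      transitivity (S_n a k w ^ r * cos x ^ q * (cos x * cos (IZR z * x))); [rewrite Hcos; ring|ring].
    * unfold scal, plus; simpl; unfold mult; simpl; ring.
Qed.

Lemma cumulant01_S_n_succ (m : nat) :
  (m <= B)%nat ->
  cumulant01 (S_n a (S k)) m = cumulant01 (S_n a k) m + arcsine_cumulant m.
Proof.
intros Hm; rewrite arcsine_cumulant_cos.
rewrite <- (cumulant01_plus (S_n a k) (fun w => cos (2 * PI * INR (a (S k)) * w))
              (fun w => cos (2 * PI * w)) m).
- apply Derive_n_ext; intros t; f_equal; apply RInt_ext; intros w _.
  rewrite S_n_succ; reflexivity.
- apply bounded_continuous_S_n.
- apply bounded_continuous_cos.
- apply bounded_continuous_cos.
- intros r q Hrq.
  destruct (S_n_pow_decorrelated r q 0) as [l [H1 H2]].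
  { rewrite Rabs_R0, Rplus_0_r, <- plus_INR; apply le_INR; lia. }
  assert (Hl : moment (fun w => cos (2 * PI * w)) q = l).
  { apply is_RInt_unique; eapply is_RInt_ext; [|exact H1].
    intros w _; cbv beta; rewrite Rmult_0_l, cos_0; apply Rmult_1_r. }
  rewrite Hl; eapply is_RInt_ext; [|exact H2].
  intros w _; cbv beta; rewrite Rmult_0_l, cos_0, Rmult_1_r; reflexivity.
Qed.

End Decorrelation.

(** * Bounded error and the limit of the normalized cumulants *)

Theorem theoremA (a : nat -> nat) (eta : R)
  (Hpos : forall k, (1 <= k)%nat -> (0 < a k)%nat)
  (Hincr : forall k, (1 <= k)%nat -> (a k < a (S k))%nat)
  (Heta : 1 < eta)
  (Htr : transcendental eta)
  (Hlim : is_lim_seq (fun k => INR (a (S k)) / INR (a k)) eta) :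
  forall m : nat, (1 <= m)%nat ->
    (exists C N : R, forall n : nat, N <= INR n ->
       Rabs (cumulant01 (S_n a n) m - INR n * arcsine_cumulant m) <= C)
    /\ is_lim_seq (fun n => cumulant01 (S_n a n) m / INR n)
                  (arcsine_cumulant m).
Proof.
intros m _.
destruct (no_small_relations a eta Hpos Hincr Heta Htr Hlim m) as [K HK].
(* From [K] on every increment is exactly [arcsine_cumulant m], so the error stays frozen at its
   value [D] at index [K]. *)
set (D := cumulant01 (S_n a K) m - INR K * arcsine_cumulant m).
assert (HD : forall n, (K <= n)%nat ->
  cumulant01 (S_n a n) m = INR n * arcsine_cumulant m + D).
{ intros n Hn; induction Hn as [|n Hn IH]; [unfold D; ring|].
  rewrite (cumulant01_S_n_succ a n m), IH, S_INR; [ring| |lia].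
  intros c; apply HK, Hn. }
split.
- exists (Rabs D), (INR K); intros n Hn; rewrite HD by (apply INR_le, Hn).
  apply Req_le; f_equal; ring.
- apply (is_lim_seq_ext_loc (fun n => arcsine_cumulant m + D * / INR n)).
  (* Starting at [K + 1] excludes [n = 0] from the division. *)
  + exists (S K); intros n Hn; rewrite HD by lia.
    field; apply not_0_INR; lia.
  + replace (Finite (arcsine_cumulant m)) with (Finite (arcsine_cumulant m + D * 0))
      by (f_equal; ring).
    apply is_lim_seq_plus'; [apply is_lim_seq_const|].
    apply is_lim_seq_mult'; [apply is_lim_seq_const|].
    apply (is_lim_seq_inv INR p_infty); [apply is_lim_seq_INR|discriminate].
Qed.
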